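(* Let $m\ge2$ and let $U$ be a subset of $\{a,b\}^m$. If the de Bruijn graph $D_U$ is strongly connected, then the graph $H_{S(U)}$ is also strongly connected. Furthermore, $D_U$ has the same period as $H_{S(U)}$.
   Context: The descent word of $\pi\in\mathfrak{S}_{n}$ is $u(\pi)=u_1\cdots u_{n-1}$, where $u_i=a$ if $\pi_i<\pi_{i+1}$ and $u_i=b$ otherwise. For $U\subseteq\{a,b\}^m$, set $S(U)=\{\pi\in\mathfrak{S}_{m+1}:u(\pi)\in U\}$. $D_U$ has vertex set $\{a,b\}^{m-1}$. For $x,y\in\{a,b\}$ and $u\in\{a,b\}^{m-2}$ with $xuy\notin U$, it has a directed edge from $xu$ to $uy$. For $S\subseteq\mathfrak{S}_{m+1}$, $H_S$ has as vertices the points of $(0,1)^m$ with pairwise distinct coordinates. It has an edge from $(x_1,\dots,x_m)$ to $(x_2,\dots,x_{m+1})$ whenever $x_1\ne x_{m+1}$ and $\Pi(x_1,\dots,x_{m+1})\notin S$, where $\Pi(x)$ is the permutation with $\pi_i<\pi_j$ if and only if $x_i<x_j$. The period of a strongly connected graph is the gcd of the lengths of closed directed walks through a fixed vertex. *)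

(* Defs.v *)
From HB Require Import structures.
From mathcomp Require Import all_boot all_order all_algebra all_fingroup.
From mathcomp Require Import reals.

Set Implicit Arguments.
Unset Strict Implicit.
Unset Printing Implicit Defensive.

Import Order.TTheory GRing.Theory Num.Theory.

(* A directed graph is given by its type of vertices and its edge relation.   *)

Fixpoint walk (T : Type) (e : T -> T -> Prop) (n : nat) (x y : T) : Prop :=
  if n is k.+1 then exists2 z, e x z & walk e k z y else x = y.

Definition strongly_connected (T : Type) (e : T -> T -> Prop) : Prop :=
  forall x y, exists n, walk e n x y.

(* d is the gcd of the set A, through the universal property of the gcd       *)
(* (so d = 0 when A has no nonzero element).                                  *)
Definition is_gcd (A : nat -> Prop) (d : nat) : Prop :=
  forall k, (k %| d)%N <-> (forall n, A n -> (k %| n)%N).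

(* The gcd is required to be d at every vertex; in a strongly connected graph *)
(* it does not depend on the vertex. The walk of length 0 does not affect it. *)
Definition has_period (T : Type) (e : T -> T -> Prop) (d : nat) : Prop :=
  forall x, is_gcd (fun n => walk e n x x) d.

(* Words over {a, b} are words over bool, with a = false and b = true.        *)

Definition descent_word (m : nat) (p : 'S_m.+1) : m.-tuple bool :=
  [tuple ~~ (p (widen_ord (leqnSn m) i) < p (lift ord0 i))%N | i < m].

Definition perms_of_words (m : nat) (U : {set m.-tuple bool}) :
  {set 'S_m.+1} := [set p | descent_word p \in U].

(* The de Bruijn graph D_U; t is the word x u y.                              *)
Definition D_edge (m : nat) (U : {set m.-tuple bool})
    (v w : m.-1.-tuple bool) : Prop :=
  exists (x y : bool) (u : seq bool) (t : m.-tuple bool),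
    [/\ t = x :: rcons u y :> seq bool, t \notin U,
        v = x :: u :> seq bool & w = rcons u y :> seq bool].

Local Open Scope ring_scope.

(* p = Pi(z); there is exactly one such p when the entries of z are distinct. *)
Definition is_pattern (R : realType) (n : nat) (z : n.-tuple R) (p : 'S_n) :
  Prop := forall i j : 'I_n, (p i < p j)%N = (tnth z i < tnth z j).

Definition H_vertex (R : realType) (m : nat) : Type :=
  {x : m.-tuple R | uniq x && all (fun t => 0 < t < 1) x}.

(* The graph H_S; z is the point (x_1, ..., x_{m+1}).                         *)
Definition H_edge (R : realType) (m : nat) (S : {set 'S_m.+1})
    (x y : H_vertex R m) : Prop :=
  exists z : m.+1.-tuple R,
    [/\ sval x = take m z :> seq R, sval y = behead z :> seq R,
        tnth z ord0 != tnth z ord_max &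
        exists2 p : 'S_m.+1, is_pattern z p & p \notin S].

(* Main.v *)
(** A walk of length n in D_U from v to v' is a word of length n + m - 1 all of
    whose factors of length m avoid U, and a walk of length n in H_S(U) is a
    sequence of n + m points whose descent word is such a word. Hence walks of
    H project to walks of D of the same length. Conversely, a word starting
    with u(x) and ending with u(y) lifts to a sequence starting with x and
    ending with y as soon as its middle part is long and contains both letters:
    the two prescribed ends can then be joined by passing above (or below) both
    of them at a change of letter, using fresh values. Strong connectivity
    provides walks through a^(m-1) and b^(m-1), so that for some N and all
    closed walks of D at u(y), of length n, there is a walk of length N + n from
    x to y in H. This gives both strong connectivity and equality of periods. *)
Require Import Defs.
From mathcomp Require Import all_boot all_order all_algebra all_fingroup.
From mathcomp Require Import boolp reals.
From mathcomp Require Import zify lra.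

Set Implicit Arguments.
Unset Strict Implicit.
Unset Printing Implicit Defensive.

Import Order.TTheory GRing.Theory Num.Theory.

(** * Walks and periods in arbitrary directed graphs *)

Section Walks.
Variables (T : Type) (e : T -> T -> Prop).

Lemma walk_cat n k x y z :
  walk e n x y -> walk e k y z -> walk e (n + k) x z.
Proof.
elim: n x => [|n IHn] x /=; first by move=> ->.
by case=> t xt /IHn ty /ty; exists t.
Qed.

(** A walk from [a] to [b] has positive length because the two vertices differ, so a detour through
    them lengthens any walk. *)
Lemma strongly_connected_long_walk (a b : T) : a <> b -> strongly_connected e ->
  forall L x y, exists2 n, L <= n & walk e n x y.
Proof.
move=> ab sc; elim=> [|L IHL] x y.
  by have [n] := sc x y; exists n.
have [n Ln xa] := IHL x a; have [[|k] /= ak] := sc a b; first by case: (ab).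
have [l bl] := sc b y; exists (n + (k.+1 + l)); first by lia.
exact: walk_cat xa (walk_cat (n := k.+1) ak bl).
Qed.

Lemma gcd_exists (A : nat -> Prop) : exists d, is_gcd A d.
Proof.
have [[n An n0]|A0] := pselect (exists2 n, A n & 0 < n); last first.
  exists 0 => k; rewrite dvdn0; split=> // _ n An.
  by case: n An => [|n] An; rewrite ?dvdn0 //; case: A0; exists n.+1.
pose P k := `[< forall n, A n -> k %| n >].
(* The gcd is the lcm of the common divisors, all of which are at most the positive element [n]. *)
exists (\big[lcmn/1]_(i < n.+1 | P i) i) => k; split=> [kd l Al | kA].
  apply: dvdn_trans kd _; apply/dvdn_biglcmP => i /asboolP; exact.
have kn : k < n.+1 by rewrite ltnS dvdn_leq // kA.
have /dvdn_biglcmP/(_ (Ordinal kn)) := dvdnn (\big[lcmn/1]_(i < n.+1 | P i) i).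
by apply; apply/asboolP.
Qed.

(** Fix walks of lengths [p] and [q] from [x] to [y] and back. A closed walk of length [n] at one
    vertex gives closed walks of lengths [p + q] and [p + q + n] at the other, so the common
    divisors at both vertices agree. *)
Lemma strongly_connected_has_period :
  strongly_connected e -> exists d, has_period e d.
Proof.
move=> sc; have [[x _]|noT] := pselect (exists x : T, True); last first.
  by exists 0 => x; case: noT; exists x.
have [d dP] := gcd_exists (fun n => walk e n x x).
exists d => y k; rewrite dP; split=> kdvd n nwalk.
  have [p xy] := sc x y; have [q yx] := sc y x.
  have := kdvd _ (walk_cat xy (walk_cat nwalk yx)).
  by have := kdvd _ (walk_cat xy yx); rewrite addnCA => kpq; rewrite dvdn_addl.
have [p xy] := sc x y; have [q yx] := sc y x.
have := kdvd _ (walk_cat yx (walk_cat nwalk xy)).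
by have := kdvd _ (walk_cat yx xy); rewrite addnCA => kpq; rewrite dvdn_addl.
Qed.

End Walks.

(** * Walks of the de Bruijn graph as words *)

Definition avoids m (U : {set m.-tuple bool}) (w : seq bool) :=
  forall t : m.-tuple bool, infix t w -> t \notin U.

Section DeBruijnWords.
Variables (m : nat) (U : {set m.-tuple bool}).
Hypothesis m2 : 2 <= m.

Lemma D_edge_tuple (v w : m.-1.-tuple bool) (t : m.-tuple bool) :
  t \notin U -> val v = take m.-1 t -> val w = behead t -> D_edge U v w.
Proof.
case: t => [[|x t] st] /= tU vt wt; first by exfalso; move: m2; rewrite -(eqP st).
case/lastP: t st tU vt wt => [|u y] st tU vt wt.
  by exfalso; move: m2; rewrite -(eqP st).
have su : m = (size u).+2 by rewrite -(eqP st) /= size_rcons.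
exists x, y, u, (Tuple st); split=> //.
by rewrite vt su /= -cats1 take_size_cat.
Qed.

(* The word of a walk, one letter being prepended per edge to the word [w] of
   what follows the walk. *)
Lemma D_walk_word n (v z : m.-1.-tuple bool) (w : seq bool) :
  walk (D_edge U) n v z -> prefix z w -> avoids U w ->
  exists p, [/\ size p = n, prefix v (p ++ w) & avoids U (p ++ w)].
Proof.
elim: n v => [|n IHn] v /= vz zw wU.
  by exists [::]; rewrite vz.
case: vz => z' [x [y [u [t [tE tU vE zE]]]]] /IHn [//|//|p [sp z'p pU]].
exists (x :: p); split; first by rewrite /= sp.
  rewrite vE /= eqxx /=; apply: prefix_trans z'p.
  by rewrite zE prefix_rcons.
(* The only new factor of length [m] is the initial one, which is the word [t] of the edge. *)
move=> t'; rewrite cat_cons infix_consl => /orP[t'p|/pU//]; suff -> : t' = t by [].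
apply: val_inj => /=; move: t'p; rewrite prefixE size_tuple => /eqP <-.
move: z'p; rewrite prefixE => /eqP z'E.
by rewrite tE -zE -{}z'E size_tuple -[in LHS](ltn_predK m2) /=.
Qed.

End DeBruijnWords.

Local Open Scope ring_scope.

(** * Real sequences with a prescribed descent word *)

Section Realization.
Variable R : realType.
Implicit Types (c d : R) (s F : seq R) (l : bool) (w : seq bool).

Definition desc s : seq bool :=
  if s is c :: s' then pairmap (fun a b => ~~ (a < b)) c s' else [::].

Lemma size_desc s : size (desc s) = (size s).-1.
Proof. by case: s => //= c s; rewrite size_pairmap. Qed.

Lemma desc_behead s : desc (behead s) = behead (desc s).
Proof. by case: s => [|c [|d s]]. Qed.

Lemma desc_take k s : desc (take k.+1 s) = take k (desc s).
Proof. by case: s => //= c s; elim: k c s => [|k IHk] c [|d s] //=; rewrite IHk. Qed.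

Lemma prefix_desc s s' : prefix s s' -> prefix (desc s) (desc s').
Proof.
by case/prefixP => t ->; case: s => [|c s]; rewrite ?prefix0s //= pairmap_cat prefix_prefix.
Qed.

Lemma exists_between_notin F c d : c < d -> exists t, [/\ c < t, t < d & t \notin F].
Proof.
elim: F d => [|a F IHF] d cd.
  by exists ((c + d) / 2); split=> //; rewrite ?(midf_lt cd).
have [/andP[ca ad]|] := boolP ((c < a) && (a < d)).
  have [t [ct ta tF]] := IHF a ca; exists t; split=> //; first exact: lt_trans ad.
  by rewrite inE negb_or tF andbT lt_eqF.
have [t [ct td tF]] := IHF d cd => nacd; exists t; split=> //.
rewrite inE negb_or tF andbT; apply: contra nacd => /eqP <-.
by rewrite ct td.
Qed.

(** Strict for both letters, so that further values fit between [c] and [d]. *)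
Definition step l c d := if l then d < c else c < d.

Lemma desc_step l c d : step l c d -> ~~ (c < d) = l.
Proof. by case: l => /= cd; [rewrite -leNgt ltW | rewrite cd]. Qed.

Lemma exists_step_notin l F c d : 0 < c < 1 -> 0 < d < 1 ->
  exists t, [/\ 0 < t < 1, step l c t, step l d t & t \notin F].
Proof.
move=> /andP[c0 c1] /andP[d0 d1]; case: l => /=.
  have [|t [t0 tm tF]] := @exists_between_notin F 0 (Num.min c d).
    by rewrite lt_min c0.
  move: tm; rewrite lt_min => /andP[tc td]; exists t; split=> //.
  by rewrite t0 (lt_trans tc).
have [|t [tm t1 tF]] := @exists_between_notin F (Num.max c d) 1.
  by rewrite gt_max c1.
move: tm; rewrite gt_max => /andP[ct dt]; exists t; split=> //.
by rewrite t1 (lt_trans c0).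
Qed.

Definition fresh F s :=
  [/\ all (fun t => 0 < t < 1) s, uniq s & {in s, forall t, t \notin F}].

Lemma fresh_cons F s t :
  0 < t < 1 -> t \notin F -> fresh (t :: F) s -> fresh F (t :: s).
Proof.
move=> t01 tF [s01 us sF]; split; rewrite /= ?t01 ?us ?andbT //.
  by apply/negP => /sF; rewrite inE eqxx.
move=> r; rewrite inE => /predU1P[->//|/sF].
by rewrite inE negb_or => /andP[].
Qed.

Lemma monotone_path l k F c d : 0 < c < 1 -> 0 < d < 1 -> step l c d ->
  exists s, fresh F s /\ pairmap (fun a b => ~~ (a < b)) c (rcons s d) = nseq k.+1 l.
Proof.
elim: k F c => [|k IHk] F c c01 d01 cd.
  by exists [::]; split; [split | rewrite /= (desc_step cd)].
have [t [tF t01 ct td]] : exists t, [/\ t \notin F, 0 < t < 1, step l c t & step l t d].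
  case: l cd {IHk} => /= cd; have [t [h1 h2 tF]] := exists_between_notin F cd;
    exists t; split=> //; lra.
have [s [sF sE]] := IHk (t :: F) t t01 d01 td.
exists (t :: s); split; first exact: fresh_cons.
by rewrite rcons_cons /= sE (desc_step ct).
Qed.

(** The path moves freely while the remaining letters are not all equal. At the last change of
    letter it goes beyond both [c] and [d], and from there it runs monotonically to [d]. *)
Lemma nonconstant_path w F c d : 0 < c < 1 -> 0 < d < 1 -> ~~ constant w ->
  exists s, fresh F s /\ pairmap (fun a b => ~~ (a < b)) c (rcons s d) = w.
Proof.
elim: w F c => [//|l w IHw] F c c01 d01 wN.
have [wC|{}wN] := boolP (constant w); last first.
  have [t [t01 ct _ tF]] := exists_step_notin l F c01 c01.
  have [s [sF sE]] := IHw (t :: F) t t01 d01 wN.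
  exists (t :: s); split; first exact: fresh_cons.
  by rewrite rcons_cons /= sE (desc_step ct).
case: w {IHw} wN wC => [//|l' w] /= wN wC.
have l'E : l' = ~~ l.
  by move: wN wC; case: l; case: l' => //= /negP nw /nw.
have {wN wC} -> : l' :: w = nseq (size w).+1 l'.
  by rewrite /= -(all_pred1P _ _ wC).
(* The turning point: a maximum if [l] is an ascent, a minimum otherwise. *)
have [t [t01 ct dt tF]] := exists_step_notin l F c01 d01.
have td : step l' t d by rewrite l'E; case: l dt {ct l'E}.
have [s [sF sE]] := monotone_path (size w) (t :: F) t01 d01 td.
exists (t :: s); split; first exact: fresh_cons.
by rewrite rcons_cons /= sE (desc_step ct).
Qed.

Lemma pattern_exists n (z : n.-tuple R) : uniq z -> exists p : 'S_n, is_pattern z p.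
Proof.
(* The permutation sends [i] to the rank of its entry, the number of smaller entries. *)
move=> uz; pose below (i : 'I_n) := [set j | tnth z j < tnth z i].
have rk_lt i : (#|below i| < n)%N.
  rewrite -[X in (_ < X)%N]card_ord -cardsT; apply: proper_card.
  by apply/properP; split; [exact: subsetT | exists i; rewrite // inE ltxx].
pose rk i := Ordinal (rk_lt i).
have rk_mono i j : tnth z i < tnth z j -> (rk i < rk j)%N.
  move=> ij /=; apply: proper_card; apply/properP; split.
    by apply/subsetP => k; rewrite !inE => /lt_trans; apply.
  by exists i; rewrite !inE ?ltxx.
have rkE i j : (rk i < rk j)%N = (tnth z i < tnth z j).
  have [/rk_mono//|ji|ij] := ltgtP (tnth z i) (tnth z j).
    by apply/negbTE; rewrite -leqNgt ltnW // rk_mono.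
  by have /tuple_uniqP/(_ _ _ ij) -> := uz; rewrite ltnn.
have rk_inj : injective rk.
  move=> i j rij; have /tuple_uniqP := uz; apply; apply/eqP.
  by rewrite eq_le !leNgt -!rkE rij !ltnn.
by exists (perm rk_inj) => i j; rewrite !permE rkE.
Qed.

Lemma descent_word_pattern m (z : m.+1.-tuple R) (p : 'S_m.+1) :
  is_pattern z p -> descent_word p = desc z :> seq bool.
Proof.
move=> zp; apply: (@eq_from_nth _ false).
  by rewrite size_desc !size_tuple.
rewrite size_tuple => i im; rewrite -[i]/(val (Ordinal im)) -tnth_nth tnth_mktuple zp.
rewrite !(tnth_nth 0) /=.
case: z {zp} => [[//|c s] /= /eqP[sm]].
by rewrite (nth_pairmap 0) // sm.
Qed.

End Realization.

(** * Projecting walks of H to the de Bruijn graph and lifting them back *)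

Section HGraph.
Variables (R : realType) (m : nat) (U : {set m.-tuple bool}).
Hypothesis m2 : (2 <= m)%N.
Local Notation H := (@H_edge R m (perms_of_words U)).
Implicit Types x y : H_vertex R m.

Lemma size_desc_vertex x : size (desc (sval x)) == m.-1.
Proof. by rewrite size_desc size_tuple. Qed.

Definition vertex_word x : m.-1.-tuple bool := Tuple (size_desc_vertex x).

Lemma H_edge_D_edge x y : H x y -> D_edge U (vertex_word x) (vertex_word y).
Proof.
case=> z [xz yz _ [p zp]]; rewrite inE => pU.
apply: (D_edge_tuple m2 pU) => /=; rewrite (descent_word_pattern zp).
  by rewrite xz -desc_take (ltn_predK m2).
by rewrite yz desc_behead.
Qed.

Lemma H_walk_D_walk n x y :
  walk H n x y -> walk (D_edge U) n (vertex_word x) (vertex_word y).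
Proof.
elim: n x => [|n IHn] x /=; first by move=> ->.
by case=> z /H_edge_D_edge xz /IHn; exists (vertex_word z).
Qed.

(** The vertices are the windows of length [m] of [s], and an edge spans a window of length [m.+1].
    Values may thus recur at distance greater than [m], which matters when [x] and [y] share
    coordinates. *)
Lemma H_walk_of_points n (s : seq R) x y :
  size s = (n + m)%N -> sval x = take m s :> seq R -> sval y = drop n s :> seq R ->
  all (fun t => 0 < t < 1) s ->
  (forall t, infix t s -> (size t <= m.+1)%N -> uniq t) ->
  avoids U (desc s) -> walk H n x y.
Proof.
elim: n s x => [|n IHn] s x ss xs ys s01 us sU /=.
  apply: val_inj; apply: val_inj => /=.
  by rewrite xs ys drop0 take_oversize // ss.
case: s ss xs ys s01 us sU => [//|a s] [ss] xs ys /andP[a01 s01] us sU.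
have st : size (take m s) == m by rewrite size_takel // ss leq_addl.
have tV : uniq (Tuple st) && all (fun t => 0 < t < 1) (Tuple st).
  apply/andP; split; last by apply/allP => r /mem_take; apply: (allP s01).
  apply: us => /=; last by rewrite (eqP st).
  by apply: infix_trans (infix_cons _ _); rewrite prefixW ?prefix_take.
exists (exist _ (Tuple st) tV); last first.
  apply: (IHn s) => //.
    by move=> t ts; apply: us => /=; rewrite ts orbT.
  move=> t ts; apply: sU; apply: infix_trans ts _.
  by rewrite -[s]/(behead (a :: s)) desc_behead; case: (desc _) => // b w; exact: infix_cons.
have sz : size (a :: take m s) == m.+1 by rewrite /= (eqP st).
have uz : uniq (Tuple sz).
  apply: us; last by rewrite size_tuple.
  by rewrite prefixW // /= eqxx prefix_take.
exists (Tuple sz); split=> //=.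
- by rewrite xs -[in LHS](ltn_predK m2) -[in RHS](ltn_predK m2) /= take_takel.
- by apply/negP => /eqP /(tuple_uniqP _ uz) /(congr1 val) /=; lia.
have [p zp] := pattern_exists uz; exists p => //.
rewrite inE; apply: sU; rewrite (descent_word_pattern zp).
by apply: prefixW; apply: prefix_desc => /=; rewrite eqxx prefix_take.
Qed.

(** A factor that starts inside [s1] is too short to reach [s2]. *)
Lemma uniq_infix_glue (s1 s s2 t : seq R) :
  uniq (s1 ++ s) -> uniq (s ++ s2) -> (size t <= (size s).+1)%N ->
  infix t (s1 ++ s ++ s2) -> uniq t.
Proof.
move=> u1 u2 st /infixP[p [q E]].
have tE : t = take (size t) (drop (size p) (s1 ++ s ++ s2)).
  by rewrite E drop_size_cat // take_size_cat.
have [le|lt] := leqP (size s1) (size p).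
  by rewrite tE drop_cat ltnNge le /= take_uniq // drop_uniq.
rewrite tE catA take_drop take_cat size_cat.
by case: ifP => c; rewrite drop_uniq ?take_uniq //; rewrite (_ : (_ - _)%N = 0%N) ?take0 ?cats0 //; lia.
Qed.

Lemma lift_word x y (w : seq bool) :
  (m < size w)%N -> ~~ constant w ->
  avoids U (desc (sval x) ++ w ++ desc (sval y)) ->
  walk H (size w + m.-1) x y.
Proof.
move=> mw wN; have /andP[ux x01] := svalP x; have /andP[uy y01] := svalP y.
have sx := size_tuple (sval x); have sy := size_tuple (sval y).
set X : seq R := sval x in ux x01 sx *; set Y : seq R := sval y in uy y01 sy *.
have XE : X = tval (sval x) by []. have YE : Y = tval (sval y) by [].
clearbody X Y.
case: X XE ux x01 sx => [|c X] XE ux x01 sx; first by exfalso; move: m2; rewrite -sx.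
case: Y YE uy y01 sy => [|d Y] YE uy y01 sy; first by exfalso; move: m2; rewrite -sy.
have c01 : 0 < last c X < 1 by apply: (allP x01); rewrite mem_last.
have d01 : 0 < d < 1 by apply: (allP y01); rewrite mem_head.
(* [w] labels the steps from the last coordinate of [x] to the first of [y], so [s] has one entry
   fewer than [w], hence at least [m] entries, all new to [x] and [y]. *)
have [s [[s01 us sF] sw]] := nonconstant_path ((c :: X) ++ d :: Y) c01 d01 wN.
have ss : size w = (size s).+1 by rewrite -sw size_pairmap size_rcons.
move=> wU; pose S := (c :: X) ++ s ++ d :: Y.
have n_eq : (size w + m.-1 = size ((c :: X) ++ s))%N.
  by rewrite ss size_cat sx -[in RHS](ltn_predK m2); lia.
apply: (@H_walk_of_points _ S).
- by rewrite n_eq /S catA size_cat sy.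
- by rewrite -XE /S -sx take_size_cat.
- by rewrite n_eq /S catA drop_size_cat.
- by rewrite /S !all_cat x01 s01 y01.
- move=> t tS st; apply: (uniq_infix_glue _ _ _ tS).
  + rewrite cat_uniq ux us andbT; apply/hasPn => r /sF.
    by rewrite mem_cat negb_or => /andP[].
  + rewrite cat_uniq us uy andbT; apply/hasPn => r rY; apply/negP => /sF.
    by rewrite mem_cat rY orbT.
  + by rewrite (leq_trans st) // -ss.
move: wU; rewrite /S /= pairmap_cat -cat_rcons pairmap_cat sw last_rcons.
by [].
Qed.

Lemma eventual_H_walk x y : strongly_connected (D_edge U) ->
  exists N, forall n, walk (D_edge U) n (vertex_word y) (vertex_word y) ->
    walk H (N + n) x y.
Proof.
move=> sc; pose A b : m.-1.-tuple bool := [tuple of nseq m.-1 b].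
have m1E : m.-1 = m.-2.+1 by lia.
have AN : A false <> A true by move/(congr1 val); rewrite /= m1E.
have long := strongly_connected_long_walk AN sc.
(* Length [m + m] leaves more than [m] letters once the word of [x] is removed. The next two walks
   are nonempty, so their words start with a and b respectively. *)
have [n1 n1m w1] := long (m + m)%N (vertex_word x) (A false).
have [n2 n2m w2] := long 1%N (A false) (A true).
have [n3 n3m w3] := long 1%N (A true) (vertex_word y).
exists (n1 + n2 + n3)%N => n w4.
(* The word of [y] has only [m.-1] letters, hence no factor of length [m]. *)
have yU : avoids U (vertex_word y).
  by move=> t /size_infix; rewrite !size_tuple m1E => tm; exfalso; lia.
have [p4 [s4 pre4 U4]] := D_walk_word m2 w4 (prefix_refl _) yU.
have [p3 [s3 pre3 U3]] := D_walk_word m2 w3 pre4 U4.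
have [p2 [s2 pre2 U2]] := D_walk_word m2 w2 pre3 U3.
have [p1 [s1 pre1 U1]] := D_walk_word m2 w1 pre2 U2.
have hd b (p q : seq bool) : (0 < size p)%N -> prefix (A b) (p ++ q) -> b \in p.
  by case: p => //= b' p _; rewrite m1E /= => /andP[/eqP-> _]; rewrite mem_head.
have fp2 : false \in p2 by apply: hd pre2; rewrite s2.
have tp3 : true \in p3 by apply: hd pre3; rewrite s3.
have p1E : p1 = vertex_word x ++ drop m.-1 p1.
  rewrite -[in LHS](cat_take_drop m.-1 p1); congr (_ ++ _).
  move: pre1; rewrite prefixE size_tuple take_cat ifT; last by rewrite s1; lia.
  by move/eqP.
(* The middle part, between the word of [x] and the word of [y]. *)
pose w := drop m.-1 p1 ++ p2 ++ p3 ++ p4.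
have sw : size w = (n1 - m.-1 + (n2 + (n3 + n)))%N.
  by rewrite !size_cat size_drop s1 s2 s3 s4.
have -> : (n1 + n2 + n3 + n = size w + m.-1)%N by rewrite sw; lia.
apply: lift_word.
- by rewrite sw; lia.
- apply/negP => wC.
  have wE b : b \in w -> w = nseq (size w) b.
    case: (w) wC => //= b' w' /all_pred1P ->; rewrite size_nseq.
    by rewrite inE mem_nseq => /orP[/eqP->|/andP[_ /eqP->]].
  have /wE fE : false \in w by rewrite !mem_cat fp2 orbT.
  have : true \in w by rewrite !mem_cat tp3 !orbT.
  by rewrite fE mem_nseq andbF.
by move: U1; rewrite p1E /w /= -!catA.
Qed.

End HGraph.

Theorem theorem4p2 (R : realType) (m : nat) (hm : (2 <= m)%N)
  (U : {set m.-tuple bool}) (hU : strongly_connected (D_edge U)) :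
  strongly_connected (@H_edge R m (perms_of_words U)) /\
  (exists d : nat, has_period (D_edge U) d /\
                   has_period (@H_edge R m (perms_of_words U)) d).
Proof.
split=> [x y|].
  have [N NP] := eventual_H_walk hm x y hU.
  by exists (N + 0)%N; apply: NP.
have [d dP] := strongly_connected_has_period hU; exists d; split=> // x k.
rewrite (dP (vertex_word x) k); split=> kdvd n nwalk.
  exact: kdvd (H_walk_D_walk hm nwalk).
have [N NP] := eventual_H_walk hm x x hU.
(* The empty closed walk lifts to length [N], and one of length [n] to [N + n]; so [k] divides their
   difference. *)
have kN : (k %| N)%N by rewrite -[N]addn0; apply/kdvd/NP.
by rewrite -(dvdn_addr _ kN); apply/kdvd/NP.
Qed.
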